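(* For a sufficiently generic $d\times n$ tropical matrix $A$ with corresponding arrangement $\mathcal{H}=\mathcal{H}(A)$, the coarse type ideal $I_{\mathbf{t}(\mathcal{H})}$ is generated by the monomials corresponding to the lattice points of the generalized permutohedron $P_{B_A}$, i.e. by the monomials $x_1^{p_1}\cdots x_d^{p_d}$ with $(p_1,\dots,p_d)\in P_{B_A}\cap\mathbb{Z}^d$.
   Context: A $d\times n$ tropical matrix is a matrix $A=(a_{ik})$ with entries in $\mathbb{R}\cup\{\infty\}$ such that every column has at least one finite entry. $B_A\subseteq K_{d,n}$ is the bipartite graph on $[d]\sqcup[n]$ with an edge $(i,k)$ iff $a_{ik}$ is finite. $A$ is sufficiently generic if the regular subdivision of the root polytope $Q_{B_A}=\mathrm{conv}\{\mathbf{e}_i-\mathbf{e}_{\bar j}:(i,j)\in E(B_A)\}\subset\mathbb{R}^{d+n}$ obtained by lifting $\mathbf{e}_i-\mathbf{e}_{\bar j}$ to height $a_{ij}$ and projecting the lower faces is a triangulation. Let $\mathbb{1}\in\mathbb{R}^d$ be the all-ones vector, $\mathbf{a}_k$ the $k$-th column of $A$, and $S_i(\mathbf{a}_k)=\{\mathbf{p}\in\mathbb{R}^d/\mathbb{R}\mathbb{1}: p_i-a_{ik}\ge p_j-a_{jk}\ \forall j\in[d]\}$ (with $p_j-\infty=-\infty$) the $i$-th closed sector of the max-tropical hyperplane with apex $\mathbf{a}_k$. The fine type of $\mathbf{p}\in\mathbb{R}^d/\mathbb{R}\mathbb{1}$ is $T(\mathbf{p})\in\{0,1\}^{d\times n}$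 with $T(\mathbf{p})_{ik}=1$ iff $a_{ik}$ is finite and $\mathbf{p}\in S_i(\mathbf{a}_k)$; the coarse type $\mathbf{t}(\mathbf{p})\in\mathbb{N}^d$ is the vector of row sums of $T(\mathbf{p})$. For a field $\Bbbk$, the coarse type ideal is $I_{\mathbf{t}(\mathcal{H})}=\langle x_1^{t_1}\cdots x_d^{t_d}:\mathbf{t}=\mathbf{t}(\mathbf{p}),\ \mathbf{p}\in\mathbb{R}^d/\mathbb{R}\mathbb{1}\rangle\subseteq\Bbbk[x_1,\dots,x_d]$. For $B\subseteq K_{d,n}$, $P_B=\sum_{j=1}^n\Delta_{N_j(B)}\subset\mathbb{R}^d$ (Minkowski sum), where $N_j(B)\subseteq[d]$ is the set of neighbours of $j\in[n]$ and $\Delta_I=\mathrm{conv}\{\mathbf{e}_i:i\in I\}$. *)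

(* Defs.v *)
From HB Require Import structures.
From mathcomp Require Import all_boot all_order all_algebra.
(* mpoly has to be imported before the mathcomp-analysis files: with the
   opposite order the grammars of the two libraries clash. *)
From mathcomp Require Import mpoly.
From mathcomp Require Import boolp classical_sets reals constructive_ereal.

Set Implicit Arguments.
Unset Strict Implicit.
Unset Printing Implicit Defensive.

Import Order.TTheory GRing.Theory Num.Theory.
Local Open Scope classical_set_scope.
Local Open Scope ring_scope.

Section ConvexGeometry.
Context {R : realType}.

(* The convex hull of the points v i for i in I; it is empty if I is. *)
Definition conv {T : finType} {N : nat} (I : {set T}) (v : T -> 'cV[R]_N) :
    set 'cV[R]_N :=
  [set x | exists w : T -> R,
     [/\ forall i, i \in I -> 0 <= w i,
         \sum_(i in I) w i = 1
       & x = \sum_(i in I) w i *: v i]].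

Definition affinely_independent {m N : nat} (v : 'I_m -> 'cV[R]_N) : Prop :=
  forall w : 'I_m -> R,
    \sum_i w i = 0 -> \sum_i w i *: v i = 0 -> forall i, w i = 0.

(* The case m = 0 makes the empty set a simplex, of dimension -1. *)
Definition is_simplex {N : nat} (S : set 'cV[R]_N) : Prop :=
  exists (m : nat) (v : 'I_m -> 'cV[R]_N),
    affinely_independent v /\ S = conv [set: 'I_m] v.

Definition face_minimizing {N : nat} (P : set 'cV[R]_N) (c : 'rV[R]_N) :
    set 'cV[R]_N :=
  [set y | P y /\ forall z, P z -> (c *m y) 0 0 <= (c *m z) 0 0].

(* The lower faces of a polytope in R^N x R are those minimizing a linear
   functional with positive coefficient on the last (height) coordinate. *)
Definition lower_face {N : nat} (P F : set 'cV[R]_(N + 1)) : Prop :=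
  exists c : 'rV[R]_(N + 1), 0 < rsubmx c 0 0 /\ F = face_minimizing P c.

Definition lifted_polytope {T : finType} {N : nat} (I : {set T})
    (v : T -> 'cV[R]_N) (h : T -> R) : set 'cV[R]_(N + 1) :=
  conv I (fun i => col_mx (v i) (h i)%:M).

(* The set of cells of the regular subdivision of conv {v i | i in I} induced
   by the heights h. *)
Definition regular_subdivision {T : finType} {N : nat} (I : {set T})
    (v : T -> 'cV[R]_N) (h : T -> R) : set (set 'cV[R]_N) :=
  [set usubmx @` F | F in lower_face (lifted_polytope I v h)].

(* A polyhedral subdivision, given by its set of cells, is a triangulation if
   all its cells are simplices. *)
Definition is_triangulation {N : nat} (C : set (set 'cV[R]_N)) : Prop :=
  forall S, C S -> is_simplex S.

Definition minkowski_sum {n N : nat} (P : 'I_n -> set 'cV[R]_N) :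
    set 'cV[R]_N :=
  [set x | exists y : 'I_n -> 'cV[R]_N,
     (forall j, P j (y j)) /\ x = \sum_j y j].

Definition lattice_points {N : nat} (P : set 'cV[R]_N) : set 'cV[int]_N :=
  [set z | P (map_mx intr z)].

End ConvexGeometry.

(* A bipartite graph B on [d] and [n] is given by its set of edges, as a
   subset of 'I_d * 'I_n. *)
Definition neighbours {d n : nat} (B : {set 'I_d * 'I_n}) (j : 'I_n) :
    {set 'I_d} := [set i | (i, j) \in B]%SET.

Section BipartiteGraph.
Context {R : realType} {d n : nat}.

(* e_i - e_{\bar j} in R^{d+n} *)
Definition root_vertex (e : 'I_d * 'I_n) : 'cV[R]_(d + n) :=
  col_mx (delta_mx e.1 0) (- delta_mx e.2 0).

Definition simplex_face (I : {set 'I_d}) : set 'cV[R]_d :=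
  conv I (fun i => delta_mx i 0).

Definition permutohedron (B : {set 'I_d * 'I_n}) : set 'cV[R]_d :=
  minkowski_sum (fun j => simplex_face (neighbours B j)).

End BipartiteGraph.
Arguments permutohedron R {d n} B.

Section TropicalMatrix.
Context {R : realType} {d n : nat}.

(* Entries lie in R u {+oo}, a subset of the extended reals. *)
Definition tropical_matrix (A : 'M[\bar R]_(d, n)) : Prop :=
  (forall i k, A i k != -oo%E) /\
  (forall k, exists i, A i k \is a fin_num).

Definition finite_graph (A : 'M[\bar R]_(d, n)) : {set 'I_d * 'I_n} :=
  [set e | A e.1 e.2 \is a fin_num]%SET.

Definition sufficiently_generic (A : 'M[\bar R]_(d, n)) : Prop :=
  is_triangulation
    (regular_subdivision (finite_graph A) root_vertex
       (fun e => fine (A e.1 e.2))).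

(* Points of R^d / R1 are given by representatives p in R^d; see
   coarse_type_translate below. In \bar R, p_j - (+oo) is -oo, as required. *)
Definition sector (a : 'cV[\bar R]_d) (i : 'I_d) : pred 'cV[R]_d :=
  [pred p : 'cV[R]_d | [forall j,
     ((p j 0%R)%:E - a j 0%R <= (p i 0%R)%:E - a i 0%R)%E]].

Definition fine_type (A : 'M[\bar R]_(d, n)) (p : 'cV[R]_d) : 'M[nat]_(d, n) :=
  \matrix_(i, k)
    nat_of_bool ((A i k \is a fin_num) && (p \in sector (col k A) i)).

Definition coarse_type (A : 'M[\bar R]_(d, n)) (p : 'cV[R]_d) : 'X_{1..d} :=
  [multinom (\sum_(k < n) fine_type A p i k)%N | i < d].

End TropicalMatrix.

Definition ideal_gen {S : comNzRingType} (G : set S) : set S :=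
  [set f | exists (m : nat) (c g : 'I_m -> S),
     (forall i, G (g i)) /\ f = \sum_i c i * g i].

Definition coarse_type_ideal (k : fieldType) {R : realType} {d n : nat}
    (A : 'M[\bar R]_(d, n)) : set {mpoly k[d]} :=
  ideal_gen [set ('X_[coarse_type A p] : {mpoly k[d]}) | p in [set: 'cV[R]_d]].
Arguments coarse_type_ideal k {R d n} A.

(* The monomial x^z for z in N^d inside Z^d. The absolute value has no effect
   on the lattice points of permutohedra, see permutohedron_lattice_absz. *)
Definition lattice_monomial (k : fieldType) {d : nat} (z : 'cV[int]_d) :
    {mpoly k[d]} := 'X_[ [multinom `|(z i 0)%R|%N | i < d] ].
Arguments lattice_monomial k {d} z.

Section Checks.
Context {R : realType} {d n : nat}.

Lemma coarse_type_translate (A : 'M[\bar R]_(d, n)) (p : 'cV[R]_d) (c : R) :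
  coarse_type A (p + const_mx c) = coarse_type A p.
Proof.
apply/mnmP => i; rewrite !mnmE; apply: eq_bigr => k _; rewrite !mxE.
congr (nat_of_bool (_ && _)); rewrite !inE; apply: eq_forallb => j.
by rewrite !mxE !EFinD 2!(addeAC _ c%:E) leeD2rE.
Qed.

Lemma permutohedron_ge0 (B : {set 'I_d * 'I_n}) (x : 'cV[R]_d) (i : 'I_d) :
  permutohedron R B x -> 0 <= x i 0.
Proof.
case=> y [yP ->]; rewrite summxE; apply: sumr_ge0 => j _.
have [w [w0 _ ->]] := yP j; rewrite summxE; apply: sumr_ge0 => l lB.
by rewrite !mxE mulr_ge0 ?w0 ?ler0n.
Qed.

Lemma permutohedron_lattice_absz (B : {set 'I_d * 'I_n}) (z : 'cV[int]_d)
    (i : 'I_d) :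
  lattice_points (permutohedron R B) z ->
  `|(z i 0)%R|%N%:Z = z i 0.
Proof.
move=> /(@permutohedron_ge0 _ _ i); rewrite mxE ler0z; exact: gez0_abs.
Qed.

End Checks.

(* Main.v *)
Require Import Defs.
From HB Require Import structures.
From mathcomp Require Import all_boot all_order all_algebra.
From mathcomp Require Import mpoly.
From mathcomp Require Import boolp classical_sets reals constructive_ereal.
From mathcomp Require Import lra zify.

(** Write h for the finite entries of A and B for its graph.  Both
families of monomials are governed by choice functions phi, which select for
each column k a neighbour phi k in B.  The degree vector of phi, which counts
how often each row is selected, is a lattice point of the permutohedron.

A point p determines such a phi by selecting, in each column, a row where
p i - h i k is maximal.  The coarse type of p counts at least these rows, so
its monomial is a multiple of the monomial of a lattice point
([coarse_type_ge_plan]).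

Conversely, every lattice point z is itself a coarse type
([lattice_point_coarse_type]).  That z lies in the permutohedron says that the
transportation problem on B with column sums 1 and row sums z is feasible over
the reals.  Give the edges the costs h.
- The transportation polytope is integral, so that there is a choice function
  phi of degree vector z which is optimal among all real plans
  ([transport_rounding], [optimal_plan]).
- Linear programming duality, from the Farkas lemma, gives potentials p and q
  with p i + q k <= h i k on B, and with equality along phi
  ([transport_dual]).  So the fine type of p contains phi, but it may be larger.
- The tight edges, where equality holds, index the vertices of one cell of the
  regular subdivision of the root polytope ([tight_cell]).  By genericity this
  cell is a simplex, so its vertices e_i - e_k are linearly independent
  ([tight_independent]).
- By this independence, some linear functional takes the value 0 on the edges
  of phi and -1 on all other tight edges.  A small move of (p, q) in
  its direction makes all edges outside phi slack ([strict_potential]).  The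
  fine type of the new p is exactly phi, and its coarse type is z. *)

Set Implicit Arguments.
Unset Strict Implicit.
Unset Printing Implicit Defensive.

Import Order.TTheory GRing.Theory Num.Theory.
Local Open Scope ring_scope.

(** * Systems of linear inequalities *)

Lemma sumZ_indic (R : pzRingType) (V : lmodType R) (T : finType) (t0 : T)
    (F : T -> V) :
  \sum_t (t == t0)%:R *: F t = F t0.
Proof.
rewrite (bigD1 t0) //= eqxx scale1r big1 ?addr0 // => t /negPf ->.
by rewrite scale0r.
Qed.

Lemma sum_indic (R : pzRingType) (T : finType) (t0 : T) (F : T -> R) :
  \sum_t (t == t0)%:R * F t = F t0.
Proof. exact: (@sumZ_indic R R^o). Qed.

Lemma finite_separation (R : realFieldType) (T : finType) (P Q : pred T)
    (f : T -> R) :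
  (forall r s, P r -> Q s -> f r <= f s) ->
  exists x, (forall r, P r -> f r <= x) /\ (forall s, Q s -> x <= f s).
Proof.
move=> PQ; case: (pickP P) => [r0 Pr0|P0].
  case: (@arg_maxP _ R T r0 P f Pr0) => r Pr rmax.
  by exists (f r); split=> [r1 /rmax //|s Qs]; exact: PQ.
case: (pickP Q) => [s0 Qs0|Q0].
  case: (@arg_minP _ R T s0 Q f Qs0) => s Qs smin.
  by exists (f s); split=> [r|s1 /smin //]; rewrite P0.
by exists 0; split=> [r|s]; rewrite ?P0 ?Q0.
Qed.

(** One step of Fourier-Motzkin elimination, where a t is the coefficient of the
variable to be eliminated in inequality t.  The new inequalities are indexed by
pairs: (s, r) stands for the positive combination of s and r that cancels the
variable if a s > 0 > a r, for s itself if a s = 0, and for the trivial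
inequality otherwise. *)
Definition fm_coef (R : realFieldType) (T : finType) (a : T -> R) (sr : T * T)
    (t : T) : R :=
  if a sr.1 == 0 then (t == sr.1)%:R
  else if (0 < a sr.1) && (a sr.2 < 0) then
    - a sr.2 * (t == sr.1)%:R + a sr.1 * (t == sr.2)%:R
  else 0.

Lemma fm_coef_ge0 (R : realFieldType) (T : finType) (a : T -> R) sr t :
  0 <= fm_coef a sr t.
Proof.
rewrite /fm_coef; case: ifP => _; first exact: ler0n.
case: ifP => // /andP[s0 r0].
by rewrite addr_ge0 // mulr_ge0 ?ler0n // ?oppr_ge0 ltW.
Qed.

Lemma fm_coef_sum (R : realFieldType) (V : lmodType R) (T : finType)
    (a : T -> R) (F : T -> V) sr :
  \sum_t fm_coef a sr t *: F t =
  if a sr.1 == 0 then F sr.1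
  else if (0 < a sr.1) && (a sr.2 < 0) then
    - a sr.2 *: F sr.1 + a sr.1 *: F sr.2
  else 0.
Proof.
rewrite /fm_coef; case: ifP => _; first exact: sumZ_indic.
case: ifP => _; last by rewrite big1 // => t _; rewrite scale0r.
under eq_bigr do rewrite scalerDl -!scalerA.
by rewrite big_split /= -!scaler_sumr !sumZ_indic.
Qed.

(** Induction on the number of variables: a solution of the eliminated system
extends, because all lower bounds on the missing coordinate lie below all upper
bounds, and a certificate against the eliminated system is one against the
original system, as its inequalities are nonnegative combinations of the
original ones. *)
Lemma farkas (R : realFieldType) (m : nat) (T : finType) (u : T -> 'rV[R]_m)
    (b : T -> R) :
  (exists x : 'cV[R]_m, forall t, (u t *m x) 0 0 <= b t) \/
  (exists l : T -> R,
     [/\ forall t, 0 <= l t, \sum_t l t *: u t = 0 & \sum_t l t * b t < 0]).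
Proof.
elim: m T u b => [|m IH] T u b.
  case: (pickP (fun t => b t < 0)) => [t bt|bge]; [right|left].
    exists (fun s => (s == t)%:R); split=> [s||]; first exact: ler0n.
      by apply/rowP; case.
    by rewrite sum_indic.
  by exists 0 => t; rewrite mulmx0 mxE leNgt bge.
pose a t : R := u t 0 0; pose v t : 'rV[R]_m := @rsubmx R 1 1 m (u t).
have uE t : u t = row_mx (a t)%:M (v t) :> 'rV_(1 + m).
  rewrite -[LHS](@hsubmxK R 1 1 m); congr (row_mx _ _).
  rewrite [LHS]mx11_scalar mxE; congr ((u t _ _)%:M); exact: val_inj.
have [[x xP]|[l [l0 lv lb]]] := IH _ (fun sr => \sum_t fm_coef a sr t *: v t)
    (fun sr => \sum_t fm_coef a sr t *: (b t : R^o)).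
  left; pose g t := b t - (v t *m x) 0 0.
  have [|x0 [x0l x0u]] := @finite_separation R T (fun r => a r < 0)
     (fun s => 0 < a s) (fun t => g t / a t).
    move=> r s ar as_; have := xP (s, r).
    rewrite !fm_coef_sum /= gt_eqF // as_ ar /=.
    rewrite mulmxDl -!scalemxAl !mxE /GRing.scale /= => H.
    rewrite ler_ndivrMr // mulrAC ler_pdivrMr // /g !mxE.
    by rewrite mulrC; lra.
  exists (col_mx x0%:M x) => t.
  have -> : u t *m (col_mx x0%:M x : 'cV_(1 + m)) = a t *: x0%:M + v t *m x.
    by rewrite uE -mul_scalar_mx; exact: (@mul_row_col R 1 1 m 1).
  rewrite mxE [X in X + _]mxE [X in _ * X]mxE eqxx mulr1n -lerBrDr -/(g t).
  have [at0|at0|at0] := ltgtP (a t) 0.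
  - by have := x0l t at0; rewrite ler_ndivrMr // mulrC.
  - by have := x0u t at0; rewrite ler_pdivlMr // mulrC.
  - have := xP (t, t); rewrite !fm_coef_sum /= at0 eqxx mul0r.
    by rewrite subr_ge0.
have swap (V : lmodType R) (F : T -> V) :
    \sum_t (\sum_sr l sr * fm_coef a sr t) *: F t =
    \sum_sr l sr *: \sum_t fm_coef a sr t *: F t.
  under eq_bigr do rewrite scaler_suml.
  rewrite exchange_big; apply: eq_bigr => sr _; rewrite scaler_sumr.
  by apply: eq_bigr => t _; rewrite scalerA.
right; exists (fun t => \sum_sr l sr * fm_coef a sr t); split.
- by move=> t; apply: sumr_ge0 => sr _; rewrite mulr_ge0 ?fm_coef_ge0.
- set w := \sum_t _.
  have wl : @lsubmx R 1 1 m w = 0.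
    rewrite linear_sum /=.
    under eq_bigr => t _ do rewrite linearZ /= uE row_mxKl.
    rewrite swap big1 // => sr _; rewrite fm_coef_sum.
    have [/eqP ->|_] := ifP; first by rewrite raddf0 scaler0.
    case: ifP => _; last by rewrite scaler0.
    rewrite -!mul_scalar_mx -!scalar_mxM -raddfD /= mulrC mulrN addNr.
    by rewrite raddf0 mulmx0.
  have wr : @rsubmx R 1 1 m w = 0.
    rewrite linear_sum /=.
    under eq_bigr => t _ do rewrite linearZ /= uE row_mxKr.
    by rewrite swap.
  by rewrite -[w](@hsubmxK R 1 1 m) wl wr; exact: (@row_mx0 R 1 1 m).
- by rewrite (swap R^o).
Qed.

(** * Integrality of the transportation polytope *)

Lemma linear_dependence (F : fieldType) (T U : finType) (E : {set T})
    (V : {set U}) (M : T -> U -> F) :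
  (#|V| < #|E|)%N ->
  exists l : T -> F,
    [/\ exists e, l e != 0, forall e, e \notin E -> l e = 0
      & forall v, v \in V -> \sum_e l e * M e v = 0].
Proof.
move=> VE.
pose N := \matrix_(i < #|E|, j < #|V|) M (enum_val i) (enum_val j).
have /rowV0Pn[x xK x0] : kermx N != 0.
  rewrite -mxrank_eq0 mxrank_ker subn_eq0 -ltnNge.
  exact: leq_ltn_trans (rank_leq_col _) VE.
have [i0 xi0] : exists i, x 0 i != 0.
  by apply/existsP; apply: contraNT x0 => /existsPn xi; apply/eqP/rowP => i;
     rewrite mxE; apply/eqP/negPn.
(* The rank of e in E needs a proof that e is in E. *)
exists (fun e => if @idP (e \in E) is ReflectT eE then
                   x 0 (enum_rank_in eE e) else 0).
have lE (i : 'I_#|E|) : (if @idP (enum_val i \in E) is ReflectT eE then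
      x 0 (enum_rank_in eE (enum_val i)) else 0) = x 0 i.
  case: {-}_ / idP => [eE|]; last by case; exact: enum_valP.
  by rewrite enum_valK_in.
split; first by exists (enum_val i0); rewrite lE.
  by move=> e /negP eE; case: {-}_ / idP.
move=> v vV; rewrite (bigID (mem E)) /= [X in _ + X]big1 ?addr0; last first.
  by move=> e /negP eE; case: {-}_ / idP => // _; rewrite mul0r.
rewrite big_enum_val /=; under eq_bigr do rewrite lE.
move/sub_kermxP/rowP/(_ (enum_rank_in vV v)): xK; rewrite !mxE => xM.
rewrite -[RHS]xM; apply: eq_bigr => i _.
by rewrite mxE enum_rankK_in.
Qed.

Lemma card_imset_double (T U : finType) (f : T -> U) (E : {set T}) :
  (forall e, e \in E -> exists2 e', e' \in E & (e' != e) && (f e' == f e)) ->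
  (2 * #|f @: E| <= #|E|)%N.
Proof.
move=> H; rewrite -[X in (_ <= X)%N]sum1_card (partition_big_imset f) /= mulnC.
rewrite -sum_nat_const.
apply: leq_sum => _ /imsetP[e eE ->]; have [e' e'E /andP[ne fe]] := H _ eE.
by rewrite (bigD1 e) ?eE ?eqxx //= (bigD1 e') ?e'E ?fe ?ne.
Qed.

Section Transportation.
Context {R : archiRealFieldType} {d n : nat}.
Implicit Types (B F : {set 'I_d * 'I_n}) (y l h : 'I_d * 'I_n -> R).

Definition row_sum y i := \sum_(e | e.1 == i) y e.
Definition col_sum y k := \sum_(e | e.2 == k) y e.

Lemma sum_rows y : \sum_e y e = \sum_i row_sum y i.
Proof. exact: (partition_big (fun e => e.1) predT). Qed.

Lemma sum_cols y : \sum_e y e = \sum_k col_sum y k.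
Proof. exact: (partition_big (fun e => e.2) predT). Qed.

Lemma row_sumE y i : row_sum y i = \sum_e y e * (e.1 == i)%:R.
Proof.
rewrite /row_sum big_mkcond; apply: eq_bigr => e _.
by case: eqP; rewrite ?mulr1 ?mulr0.
Qed.

Lemma col_sumE y k : col_sum y k = \sum_e y e * (e.2 == k)%:R.
Proof.
rewrite /col_sum big_mkcond; apply: eq_bigr => e _.
by case: eqP; rewrite ?mulr1 ?mulr0.
Qed.

Lemma row_sum_col y i : row_sum y i = \sum_k y (i, k).
Proof.
rewrite row_sumE (eq_bigr (fun e => y (e.1, e.2) * (e.1 == i)%:R)) => [|[]//].
rewrite -(pair_bigA _ (fun a k => y (a, k) * (a == i)%:R)) exchange_big.
by apply: eq_bigr => k _; under eq_bigr do rewrite mulrC; exact: sum_indic.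
Qed.

Lemma col_sum_row y k : col_sum y k = \sum_i y (i, k).
Proof.
rewrite col_sumE (eq_bigr (fun e => y (e.1, e.2) * (e.2 == k)%:R)) => [|[]//].
rewrite -(pair_bigA _ (fun i a => y (i, a) * (a == k)%:R)).
by apply: eq_bigr => i _; under eq_bigr do rewrite mulrC; exact: sum_indic.
Qed.

(** If F meets every row and every column that it touches at least twice, then
it has at least as many edges as touched rows and columns together.  A
circulation on F satisfies one linear condition for each of them, and one of
these conditions is redundant since the row sums and the column sums have the
same total; so the conditions have a nonzero solution. *)
Lemma exists_circulation F :
  F != finset.set0 ->
  (forall e, e \in F -> exists2 e', e' \in F & (e' != e) && (e'.1 == e.1)) ->
  (forall e, e \in F -> exists2 e', e' \in F & (e' != e) && (e'.2 == e.2)) ->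
  exists l,
    [/\ exists e, l e != 0, forall e, e \notin F -> l e = 0,
        forall i, row_sum l i = 0 & forall k, col_sum l k = 0].
Proof.
move=> /set0Pn[e0 e0F] /card_imset_double rF /card_imset_double cF.
pose rows := [set e.1 | e in F]%SET; pose cols := [set e.2 | e in F]%SET.
pose V : {set 'I_d + 'I_n} :=
  ((@inl 'I_d 'I_n @: (rows :\ e0.1)) :|: (@inr 'I_d 'I_n @: cols))%SET.
pose M (e : 'I_d * 'I_n) (v : 'I_d + 'I_n) : R :=
  match v with inl i => (e.1 == i)%:R | inr k => (e.2 == k)%:R end.
(* V omits the row of e0, whose condition follows from the others. *)
have cV : (#|V| < #|F|)%N.
  have e0r : e0.1 \in rows by apply/imsetP; exists e0.
  have := cardsD1 e0.1 rows; rewrite e0r.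
  have := leq_card_setU (@inl 'I_d 'I_n @: (rows :\ e0.1))
    (@inr 'I_d 'I_n @: cols).
  have inlI : injective (@inl 'I_d 'I_n) by move=> ? ? [].
  have inrI : injective (@inr 'I_d 'I_n) by move=> ? ? [].
  rewrite -/V (card_imset _ inlI) (card_imset _ inrI).
  move: rF cF; rewrite -/rows -/cols.
  move: #|V| #|F| #|rows| #|cols| #|_ :\ _| => a b c e f; clear.
  by move=> rF cF [le _] ce; rewrite add1n in ce; lia.
have [l [l0 lF lV]] := linear_dependence M cV.
have col0 k : col_sum l k = 0.
  have [kc|kc] := boolP (k \in cols).
    by rewrite col_sumE (lV (inr k)) // inE imset_f // orbT.
  apply: big1 => e /eqP ek; apply: lF; apply: contra kc => eF.
  by rewrite -ek imset_f.
have row0 i : i != e0.1 -> row_sum l i = 0.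
  move=> i0; have [ic|ic] := boolP (i \in rows).
    by rewrite row_sumE (lV (inl i)) // !inE imset_f ?inE ?i0.
  apply: big1 => e /eqP ek; apply: lF; apply: contra ic => eF.
  by rewrite -ek imset_f.
exists l; split=> // i; have [->|] := eqVneq i e0.1; last exact: row0.
have := sum_rows l; rewrite sum_cols big1 // (bigD1 e0.1) //= big1 ?addr0 //.
Qed.

Definition transport B (z : 'I_d -> R) y : Prop :=
  [/\ forall e, 0 <= y e, forall e, e \notin B -> y e = 0,
      forall i, row_sum y i = z i & forall k, col_sum y k = 1].

Definition cost h y := \sum_e h e * y e.

Definition plan_of (phi : 'I_n -> 'I_d) (e : 'I_d * 'I_n) : R :=
  (phi e.2 == e.1)%:R.

Lemma row_sum_plan (phi : 'I_n -> 'I_d) i :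
  row_sum (plan_of phi) i = (\sum_k (phi k == i))%N%:R :> R.
Proof. by rewrite row_sum_col natr_sum. Qed.

Lemma int_sum_partner (T : finType) (P : pred T) (f : T -> R) (e : T) :
  \sum_(t | P t) f t \is a Num.int -> P e -> f e \isn't a Num.int ->
  exists2 e', f e' \isn't a Num.int & (e' != e) && P e'.
Proof.
move=> fi Pe fe.
have /existsP[e' /andP[]] :
  [exists e', (f e' \isn't a Num.int) && ((e' != e) && P e')];
  last by exists e'.
apply: contraNT fe => /existsPn H.
have -> : f e = \sum_(t | P t) f t - \sum_(t | P t && (t != e)) f t.
  by rewrite (bigD1 e) //= addrK.
rewrite rpredB // rpred_sum // => t /andP[Pt te].
by have := H t; rewrite te Pt !andbT negbK.
Qed.

(** The sums of y along rows and columns are integers, so no row or column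
contains exactly one non-integral entry, and the non-integral edges carry a
circulation l.  Up to sign, moving along l does not increase the cost; since l
has a negative entry, the move can go on until some entry of the plan vanishes,
and integral entries stay fixed. *)
Lemma round_step B z h y :
  (forall i, z i \is a Num.int) -> transport B z y ->
  (exists e, y e \isn't a Num.int) ->
  exists y', [/\ transport B z y', cost h y' <= cost h y
    & [set e | y' e \isn't a Num.int]%SET \proper
      [set e | y e \isn't a Num.int]%SET].
Proof.
move=> zi [y0 yB yr yc] [e0 ye0].
set F := finset.finset _.
have [||| l [l0 lF lr lc]] := @exists_circulation F.
- by apply/set0Pn; exists e0; rewrite inE.
- move=> e; rewrite inE => ye.
  have [||e' ? ?] := @int_sum_partner _ (fun t => t.1 == e.1) y e _ _ ye.
  + by rewrite -/(row_sum y e.1) yr.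
  + exact: eqxx.
  by exists e'; rewrite ?inE.
- move=> e; rewrite inE => ye.
  have [||e' ? ?] := @int_sum_partner _ (fun t => t.2 == e.2) y e _ _ ye.
  + by rewrite -/(col_sum y e.2) yc.
  + exact: eqxx.
  by exists e'; rewrite ?inE.
wlog lh : l l0 lF lr lc / cost h l <= 0.
  move=> W; have [/W|/ltW lh] := leP (cost h l) 0; first exact.
  apply: (W (fun e => - l e)).
  - by case: l0 => e le; exists e; rewrite oppr_eq0.
  - by move=> e /lF ->; rewrite oppr0.
  - by move=> i; rewrite /row_sum sumrN -/(row_sum l i) lr oppr0.
  - by move=> i; rewrite /col_sum sumrN -/(col_sum l i) lc oppr0.
  - by rewrite /cost; under eq_bigr do rewrite mulrN; rewrite sumrN oppr_le0.
have [e1 le1] : exists e, l e < 0.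
  have /existsP// : [exists e, l e < 0].
  case: l0 => e le; apply: contraNT le => /existsPn lp.
  have := lr e.1; rewrite /row_sum (bigD1 e) //= => /eqP.
  rewrite paddr_eq0 ?leNgt ?lp //; first by case/andP.
  by rewrite -leNgt; apply: sumr_ge0 => f _; rewrite leNgt lp.
(* e is the entry that vanishes first, after a move by t. *)
case: (@arg_minP _ R _ e1 (fun e => l e < 0)
  (fun e => y e / - l e) le1) => e le min.
pose t := y e / - l e.
have t0 : 0 <= t by rewrite divr_ge0 // oppr_ge0 ltW.
exists (fun f => y f + t * l f); split.
- split=> [f|f fB|i|k].
  + have [lf|lf] := leP 0 (l f); first by rewrite addr_ge0 // mulr_ge0.
    have := min f lf; rewrite -/t ler_pdivlMr ?oppr_gt0 // mulrN.
    by rewrite -subr_ge0 opprK.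
  + rewrite yB // lF ?mulr0 ?addr0 // inE yB // negbK; exact: int_num0.
  + by rewrite /row_sum big_split /= -mulr_sumr -!/(row_sum _ i) lr mulr0 addr0.
  + by rewrite /col_sum big_split /= -mulr_sumr -!/(col_sum _ k) lc mulr0 addr0.
- rewrite /cost; under eq_bigr do rewrite mulrDr mulrCA.
  by rewrite big_split /= -mulr_sumr gerDl mulr_ge0_le0.
- have eF : e \in F by apply: contraTT le => /lF ->; rewrite ltxx.
  apply/properP; split; last first.
    exists e => //; rewrite inE negbK /t -mulrA invrN mulNr mulVf ?lt_eqF //.
    by rewrite mulrN1 subrr int_num0.
  apply/fintype.subsetP => f; rewrite inE; apply: contraNT => fF.
  by rewrite lF // mulr0 addr0; move: fF; rewrite inE negbK.
Qed.

(** A nonnegative integral column with sum 1 has one entry 1 and zeros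
elsewhere. *)
Lemma int_transport_plan B z y :
  transport B z y -> (forall e, y e \is a Num.int) ->
  exists phi : {ffun 'I_n -> 'I_d}, y =1 plan_of phi.
Proof.
move=> [y0 yB yr yc] yi.
have ge1 e : y e != 0 -> 1 <= y e.
  by move=> ye; have := norm_intr_ge1 (yi e) ye; rewrite ger0_norm.
have ex k : exists i, y (i, k) != 0.
  apply/existsP; apply: contraT => /existsPn H.
  have /eqP := yc k; rewrite /col_sum big1; first by rewrite eq_sym oner_eq0.
  by move=> -[i k'] /= /eqP ->; apply/eqP; have := H i; rewrite negbK.
exists [ffun k => xchoose (ex k)] => -[i k]; rewrite /plan_of ffunE /=.
have := xchooseP (ex k); move: (xchoose _) => j yj.
have := yc k; rewrite /col_sum (bigD1 (j, k)) //=.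
have [<-{i}|ji] := eqVneq j i.
  move=> s; have s0 : 0 <= \sum_(e | (e.2 == k) && (e != (j, k))) y e.
    exact: sumr_ge0.
  by apply/eqP; rewrite eq_le ge1 // andbT -s lerDl.
rewrite (bigD1 (i, k)) ?eqxx /=; last first.
  by apply: contra ji => /eqP[->].
have := ge1 _ yj; have := y0 (i, k).
have : 0 <= \sum_(e | (e.2 == k) && (e != (j, k)) && (e != (i, k))) y e.
  exact: sumr_ge0.
by move=> /= *; lra.
Qed.

Lemma transport_rounding B z h y :
  (forall i, z i \is a Num.int) -> transport B z y ->
  exists phi : {ffun 'I_n -> 'I_d},
    transport B z (plan_of phi) /\ cost h (plan_of phi) <= cost h y.
Proof.
move=> zi; have [N] := ubnP #|[set e | y e \isn't a Num.int]%SET|.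
elim: N y => // N IH y; rewrite ltnS => yN yT.
have [/existsP ye|/existsPn ye] := boolP [exists e, y e \isn't a Num.int].
  have [y' [y'T hy' /proper_card y'p]] := round_step h zi yT ye.
  have [|phi [phiT hphi]] := IH y' _ y'T; first exact: leq_trans yN.
  by exists phi; split=> //; exact: le_trans hy'.
have [|phi yphi] := int_transport_plan yT.
  by move=> e; have := ye e; rewrite negbK.
by exists phi; have <- : y = plan_of phi by apply/funext.
Qed.

(** There are finitely many choice functions, and by rounding a cheapest one
among them is at most as expensive as any real plan. *)
Lemma optimal_plan B z h y :
  (forall i, z i \is a Num.int) -> transport B z y ->
  exists phi : {ffun 'I_n -> 'I_d},
    transport B z (plan_of phi) /\
    forall y', transport B z y' -> cost h (plan_of phi) <= cost h y'.
Proof.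
move=> zi yT; have [phi0 [phi0T _]] := transport_rounding h zi yT.
case: (@arg_minP _ R _ phi0 (fun phi => `[< transport B z (plan_of phi) >])
   (fun phi => cost h (plan_of phi))); first exact/asboolP.
move=> phi /asboolP phiT min; exists phi; split=> // y' y'T.
have [psi [psiT hpsi]] := transport_rounding h zi y'T.
by apply: le_trans hpsi; apply: min; apply/asboolP.
Qed.

End Transportation.

(** * Duality for the transportation problem *)

Lemma sum_unit (V : nmodType) (F : unit -> V) : \sum_t F t = F tt.
Proof. by apply: big_pred1 => -[]. Qed.

Section Duality.
Context {R : archiRealFieldType} {d n : nat}.
Implicit Types (B F : {set 'I_d * 'I_n}) (y l h : 'I_d * 'I_n -> R).

Lemma sum_potential y (p : 'I_d -> R) (q : 'I_n -> R) :
  \sum_e (p e.1 + q e.2) * y e =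
  \sum_i p i * row_sum y i + \sum_k q k * col_sum y k.
Proof.
under eq_bigr do rewrite mulrDl.
rewrite big_split /=; congr (_ + _).
  rewrite sum_rows; apply: eq_bigr => i _; rewrite mulr_sumr.
  by apply: eq_bigr => e /eqP ->.
rewrite sum_cols; apply: eq_bigr => k _; rewrite mulr_sumr.
by apply: eq_bigr => e /eqP ->.
Qed.

(** The Farkas lemma is applied to the system p i + q k <= h (i, k) on B,
together with the requirement that the dual objective be at least the cost of
phi.  For a solution, the slacks along phi are nonnegative with nonpositive
sum, so they vanish.  A certificate of infeasibility, divided by the multiplier mu of
the objective, would be a real plan cheaper than phi; and mu = 0 forces the
whole certificate to vanish. *)
Lemma transport_dual B (z : 'I_d -> R) h (phi : 'I_n -> 'I_d) :
  transport B z (plan_of phi) ->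
  (forall y, transport B z y -> cost h (plan_of phi) <= cost h y) ->
  exists (p : 'I_d -> R) (q : 'I_n -> R),
    (forall e, e \in B -> p e.1 + q e.2 <= h e) /\
    (forall k, p (phi k) + q k = h (phi k, k)).
Proof.
move=> phiT phimin; have [phi0 phiB phir phic] := phiT.
pose u (t : 'I_d * 'I_n + unit) : 'rV[R]_(d + n) :=
  match t with
  | inl e => (e \in B)%:R *: row_mx (delta_mx 0 e.1) (delta_mx 0 e.2)
  | inr _ => - row_mx (\row_i z i) (const_mx 1)
  end.
pose b (t : 'I_d * 'I_n + unit) : R :=
  match t with
  | inl e => (e \in B)%:R * h e
  | inr _ => - cost h (plan_of phi)
  end.
have [[x xP]|[l [l0 lu lb]]] := farkas u b.
  move: xP; rewrite -(vsubmxK x); move: (usubmx x) (dsubmx x) => P Q xP.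
  pose p i := P i 0; pose q k := Q k 0.
  have pq e : e \in B -> p e.1 + q e.2 <= h e.
    move=> eB; have := xP (inl e).
    by rewrite /u /b eB scale1r mul1r mul_row_col -!rowE !mxE.
  have S : \sum_e (h e - (p e.1 + q e.2)) * plan_of phi e <= 0.
    under eq_bigr do rewrite mulrBl.
    rewrite sumrB sum_potential -/(cost _ _).
    have zP : (\row_i z i *m P) 0 0 = \sum_i p i * row_sum (plan_of phi) i.
      by rewrite mxE; apply: eq_bigr => i _; rewrite mxE phir mulrC.
    have oQ : ((const_mx 1 : 'rV_n) *m Q) 0 0 =
        \sum_k q k * col_sum (plan_of phi) k.
      by rewrite mxE; apply: eq_bigr => k _; rewrite mxE phic mulrC.
    have := xP (inr tt); rewrite /u /b mulNmx mul_row_col mxE [X in - X]mxE.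
    by rewrite zP oQ lerN2 subr_le0.
  have S0 e : 0 <= (h e - (p e.1 + q e.2)) * plan_of phi e.
    have [eB|/phiB ->] := boolP (e \in B); last by rewrite mulr0.
    by rewrite mulr_ge0 // subr_ge0 pq.
  exists p, q; split=> // k; apply/esym/eqP; rewrite -subr_eq0.
  have /eqP : \sum_e (h e - (p e.1 + q e.2)) * plan_of phi e = 0.
    by apply/eqP; rewrite eq_le S sumr_ge0.
  rewrite psumr_eq0 // => /allP /(_ (phi k, k)).
  by rewrite mem_index_enum /plan_of /= eqxx mulr1; exact.
pose mu := l (inr tt); pose la e := l (inl e) * (e \in B)%:R.
have sumu : \sum_e la e *: row_mx (delta_mx 0 e.1) (delta_mx 0 e.2) =
    mu *: row_mx (\row_i z i) (const_mx 1) :> 'rV[R]_(d + n).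
  move/eqP: lu; rewrite big_sumType /= sum_unit scalerN subr_eq0 => /eqP <-.
  by apply: eq_bigr => e _; rewrite scalerA.
have lar i : row_sum la i = mu * z i.
  have /rowP/(_ (lshift n i)) := sumu.
  rewrite summxE [RHS]mxE row_mxEl mxE => <-.
  rewrite row_sumE; apply: eq_bigr => e _.
  by rewrite mxE row_mxEl mxE eqxx /= eq_sym.
have lac k : col_sum la k = mu.
  have /rowP/(_ (rshift d k)) := sumu.
  rewrite summxE [RHS]mxE row_mxEr mxE mulr1 => <-.
  rewrite col_sumE; apply: eq_bigr => e _.
  by rewrite mxE row_mxEr mxE eqxx /= eq_sym.
have lacost : cost h la < mu * cost h (plan_of phi).
  move: lb; rewrite big_sumType /= sum_unit mulrN subr_lt0.
  by congr (_ < _); apply: eq_bigr => e _; rewrite mulrA mulrC.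
have la0 e : 0 <= la e by rewrite mulr_ge0.
have : 0 <= mu by exact: l0.
rewrite le_eqVlt => /predU1P[mu0|mu0].
  have laz e : la e = 0.
    apply/eqP; rewrite eq_le la0 andbT.
    have := lac e.2; rewrite -mu0 /col_sum (bigD1 e) //= => <-.
    by rewrite lerDl sumr_ge0.
  move: lacost; rewrite -mu0 mul0r /cost big1 ?ltxx // => e _.
  by rewrite laz mulr0.
have muV := mulVf (lt0r_neq0 mu0).
have /phimin : transport B z (fun e => mu^-1 * la e).
  split=> [e|e /negPf eB|i|k].
  - by rewrite mulr_ge0 // invr_ge0 ltW.
  - by rewrite /la eB !mulr0.
  - by rewrite /row_sum -mulr_sumr -/(row_sum la i) lar mulrA muV mul1r.
  - by rewrite /col_sum -mulr_sumr -/(col_sum la k) lac.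
rewrite leNgt /cost; under [X in X < _]eq_bigr do rewrite mulrCA.
by rewrite -mulr_sumr -/(cost h la) mulrC ltr_pdivrMr // mulrC lacost.
Qed.

End Duality.

(** * Cells of the regular subdivision *)

Section Convex.
Context {R : realType}.

Definition pairing {N : nat} (c : 'rV[R]_N) (x : 'cV[R]_N) : R := (c *m x) 0 0.

Lemma pairing_sum N (c : 'rV[R]_N) (T : finType) (P : pred T) (w : T -> R)
    (v : T -> 'cV[R]_N) :
  pairing c (\sum_(t | P t) w t *: v t) = \sum_(t | P t) w t * pairing c (v t).
Proof.
rewrite /pairing mulmx_sumr summxE; apply: eq_bigr => t _.
by rewrite -scalemxAr mxE.
Qed.

Lemma conv_vertex N (T : finType) (I : {set T}) (v : T -> 'cV[R]_N) e :
  e \in I -> conv I v (v e).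
Proof.
move=> eI; exists (fun t => (t == e)%:R); split=> [t _||].
- exact: ler0n.
- by rewrite (bigD1 e) //= eqxx big1 ?addr0 // => t /andP[_ /negPf ->].
- rewrite (bigD1 e) //= eqxx scale1r big1 ?addr0 // => t /andP[_ /negPf ->].
  by rewrite scale0r.
Qed.

Lemma exposed_vertex N (T : finType) (I : {set T}) (v : T -> 'cV[R]_N) e
    (c : 'rV[R]_N) x :
  e \in I ->
  (forall e', e' \in I -> e' != e -> pairing c (v e') < pairing c (v e)) ->
  conv I v x ->
  pairing c x <= pairing c (v e) /\ (pairing c x = pairing c (v e) -> x = v e).
Proof.
move=> eI cI [w [w0 w1 ->]].
have gap : pairing c (v e) - pairing c (\sum_(t in I) w t *: v t) =
    \sum_(t in I) w t * (pairing c (v e) - pairing c (v t)).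
  under [RHS]eq_bigr do rewrite mulrBr.
  by rewrite sumrB -mulr_suml w1 mul1r pairing_sum.
have gap0 t : t \in I -> 0 <= w t * (pairing c (v e) - pairing c (v t)).
  move=> tI; rewrite mulr_ge0 ?w0 // subr_ge0.
  by have [->//|te] := eqVneq t e; rewrite ltW // cI.
split=> [|xe]; first by rewrite -subr_ge0 gap sumr_ge0.
move: gap; rewrite xe subrr => /esym/eqP; rewrite psumr_eq0 // => /allP H.
have wt t : t \in I -> t != e -> w t = 0.
  move=> tI te; have := H t (mem_index_enum _); rewrite tI /= mulf_eq0.
  by rewrite subr_eq0 (gt_eqF (cI t tI te)) orbF => /eqP.
move: w1; rewrite (bigD1 e) //= big1 ?addr0 => [we|t /andP[]]; last exact: wt.
rewrite (bigD1 e) //= we scale1r big1 ?addr0 // => t /andP[tI te].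
by rewrite wt // scale0r.
Qed.

(** A point v e exposed by a linear functional is extreme in the convex hull,
so it is one of the vertices u j of the simplex: in the convex combination of
the u j that gives it, every term with nonzero weight must attain the maximum.
Hence v is, on I, a subfamily of an affinely independent family. *)
Lemma simplex_vertices_independent N (T : finType) (I : {set T})
    (v : T -> 'cV[R]_N) :
  is_simplex (conv I v) ->
  (forall e, e \in I -> exists c : 'rV[R]_N,
     forall e', e' \in I -> e' != e -> pairing c (v e') < pairing c (v e)) ->
  forall w : T -> R,
    \sum_(e in I) w e = 0 -> \sum_(e in I) w e *: v e = 0 ->
    forall e, e \in I -> w e = 0.
Proof.
move=> [m [u [uindep convE]]] exposed.
have ve e : e \in I -> exists j, u j = v e.
  move=> eI; have [c cI] := exposed e eI.
  have uconv j : conv I v (u j).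
    by rewrite convE; apply: conv_vertex; rewrite inE.
  have : conv I v (v e) by exact: conv_vertex.
  rewrite {1}convE => -[al [al0 al1 veE]].
  have [j alj] : exists j, al j != 0.
    apply/existsP; apply: contraT => /existsPn H.
    have /eqP := al1; rewrite big1 ?(eq_sym 0) ?oner_eq0 // => j _.
    by have /negPn/eqP := H j.
  exists j; apply: (exposed_vertex eI cI (uconv j)).2.
  have S :
    \sum_(j in finset.setT) al j * (pairing c (v e) - pairing c (u j)) = 0.
    under eq_bigr do rewrite mulrBr.
    by rewrite sumrB -mulr_suml al1 mul1r -pairing_sum -veE subrr.
  move/eqP: S; rewrite psumr_eq0 => [/allP/(_ j (mem_index_enum _))|i iT].
    by rewrite inE /= mulf_eq0 (negPf alj) subr_eq0 eq_sym => /eqP.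
  rewrite mulr_ge0 ?al0 // subr_ge0.
  exact: (exposed_vertex eI cI (uconv i)).1.
move=> w ws wv e0 e0I.
have [j0 _] := ve e0 e0I.
pose f e := odflt j0 [pick j | u j == v e].
have fE e : e \in I -> u (f e) = v e.
  move=> /ve[j uj]; rewrite /f; case: pickP => [i /eqP //|/(_ j)].
  by rewrite uj eqxx.
have fI e e' : e \in I -> e' \in I -> f e = f e' -> e = e'.
  move=> eI e'I ff; apply/eqP; apply: contraT => ee'.
  have [c cI] := exposed e' e'I.
  by have := cI e eI ee'; rewrite -!fE // ff ltxx.
have : \sum_(e in I | f e == f e0) w e = 0.
  apply: (uindep (fun j => \sum_(e in I | f e == j) w e)).
    by rewrite -[RHS]ws [RHS](partition_big f predT).
  rewrite -[RHS]wv [RHS](partition_big f predT) //=; apply: eq_bigr => j _.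
  by rewrite scaler_suml; apply: eq_bigr => e /andP[eI /eqP <-]; rewrite fE.
rewrite (big_pred1 e0) // => e.
by apply/andP/eqP => [[eI /eqP]|->]; [exact: fI|split].
Qed.

End Convex.

Section Cells.
Context {R : realType} {d n : nat}.
Implicit Types (B G : {set 'I_d * 'I_n}) (h : 'I_d * 'I_n -> R).

Lemma pairing_root (s : 'rV[R]_d) (r : 'rV[R]_n) (e : 'I_d * 'I_n) :
  pairing (row_mx s r) (@root_vertex R d n e) = s 0 e.1 - r 0 e.2.
Proof.
by rewrite /pairing /root_vertex mul_row_col mulmxN -!colE !mxE.
Qed.

(** Evaluating x_i - x_k, for e = (i, k), counts the endpoints shared with e:
the value is 2 at e itself and at most 1 at the other edges. *)
Lemma root_vertex_exposed (e e' : 'I_d * 'I_n) : e' != e ->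
  pairing (row_mx (delta_mx 0 e.1) (- delta_mx 0 e.2)) (@root_vertex R d n e') <
  pairing (row_mx (delta_mx 0 e.1) (- delta_mx 0 e.2))
    (@root_vertex R d n e).
Proof.
move=> ee'; rewrite !pairing_root !mxE !eqxx /= !opprK.
rewrite -!natrD ltr_nat.
have : ~~ ((e'.1 == e.1) && (e'.2 == e.2)).
  by move: ee'; case: e e' => [i k] [i' k'].
by case: eqP; case: eqP.
Qed.

Definition tight B h (p : 'I_d -> R) (q : 'I_n -> R) : {set 'I_d * 'I_n} :=
  [set e in B | p e.1 + q e.2 == h e]%SET.

(** The functional (-p, q, 1) takes on a lifted vertex its slack
h e - p e.1 - q e.2.  Its minimum over the lifted polytope is 0, attained by the
convex combinations that only involve tight edges. *)
Lemma tight_cell B h p q :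
  (forall e, e \in B -> p e.1 + q e.2 <= h e) ->
  tight B h p q != finset.set0 ->
  regular_subdivision B root_vertex h (conv (tight B h p q) root_vertex).
Proof.
move=> pq /set0Pn[e0]; rewrite inE => /andP[e0B /eqP e0h].
set G := tight B h p q.
pose c : 'rV[R]_(d + n + 1) :=
  row_mx (row_mx (\row_i - p i) (\row_k q k)) 1%:M.
pose lift e : 'cV[R]_(d + n + 1) := col_mx (@root_vertex R d n e) (h e)%:M.
pose gap e := h e - (p e.1 + q e.2).
have cl e : pairing c (lift e) = gap e.
  rewrite /pairing mul_row_col mul1mx mxE -/(pairing _ _) pairing_root !mxE.
  by rewrite eqxx mulr1n addrC /gap opprD.
have gap0 e : e \in B -> 0 <= gap e by move=> eB; rewrite subr_ge0 pq.
have cge0 w : (forall e, e \in B -> 0 <= w e) ->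
    0 <= pairing c (\sum_(e in B) w e *: lift e).
  move=> w0; rewrite pairing_sum sumr_ge0 // => e eB.
  by rewrite cl mulr_ge0 ?w0 ?gap0.
have GB e : e \in G -> e \in B by rewrite inE => /andP[].
have restrict (V : nmodType) (F : _ -> V) :
    (forall e, e \in B -> e \notin G -> F e = 0) ->
    \sum_(e in B) F e = \sum_(e in G) F e.
  move=> FG; rewrite (big_setID G) /= [X in _ + X]big1 ?addr0 => [|e].
    by apply: eq_bigl => e; rewrite inE andbC;
       case: (boolP (e \in G)) => // /GB ->.
  by rewrite inE => /andP[eG eB]; rewrite FG.
exists (face_minimizing (lifted_polytope B root_vertex h) c).
  exists c; split=> //; rewrite row_mxKr mxE eqxx; exact: ltr01.
apply/seteqP; split=> x /=.
  move=> [y [[w [w0 w1 yE]] ymin] <-].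
  have /ymin : lifted_polytope B root_vertex h (lift e0) by exact: conv_vertex.
  rewrite -!/(pairing _ _) cl /gap e0h subrr yE pairing_sum => le0.
  have term0 e : e \in B -> 0 <= w e * pairing c (lift e).
    by move=> eB; rewrite cl mulr_ge0 ?w0 ?gap0.
  have /eqP : \sum_(e in B) w e * pairing c (lift e) = 0.
    by apply/eqP; rewrite eq_le le0 sumr_ge0.
  rewrite psumr_eq0 // => /allP H.
  have wG e : e \in B -> e \notin G -> w e = 0.
    move=> eB; rewrite inE eB /= => eG.
    have := H e (mem_index_enum _); rewrite eB /= cl mulf_eq0 subr_eq0.
    by rewrite (eq_sym (h e)) (negPf eG) orbF => /eqP.
  exists w; split=> [e /GB /w0 //||].
    by rewrite -w1 restrict.
  rewrite linear_sum -restrict => [|e eB eG]; last by rewrite wG // scale0r.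
  by apply: eq_bigr => e _; rewrite linearZ /= col_mxKu.
move=> [w [w0 w1 ->]].
pose w' e := if e \in G then w e else 0.
have w'G e : e \in B -> e \notin G -> w' e = 0 by rewrite /w' => _ /negPf ->.
have w'0 e : e \in B -> 0 <= w' e by rewrite /w'; case: ifP => // /w0.
have restrict' : \sum_(e in B) w' e *: lift e = \sum_(e in G) w' e *: lift e.
  by apply: restrict => e eB eG; rewrite w'G // scale0r.
exists (\sum_(e in B) w' e *: lift e).
  split.
    exists w'; split=> //; rewrite restrict // -w1.
    by apply: eq_bigr => e eG; rewrite /w' eG.
  move=> _ [w2 [w20 _ ->]]; rewrite -!/(pairing _ _).
  apply: le_trans (cge0 _ w20); rewrite restrict' // pairing_sum big1 // => e.
  by rewrite cl inE => /andP[_ /eqP eh]; rewrite /gap eh subrr mulr0.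
rewrite restrict' linear_sum; apply: eq_bigr => e eG.
by rewrite linearZ /= col_mxKu /w' eG.
Qed.

(** The vertices e_i - e_k lie on the hyperplane where the first d coordinates
sum to 1, so that their affine independence is a linear one. *)
Lemma tight_independent B h p q :
  is_triangulation (regular_subdivision B root_vertex h) ->
  (forall e, e \in B -> p e.1 + q e.2 <= h e) ->
  forall w : 'I_d * 'I_n -> R,
    \sum_(e in tight B h p q) w e *: root_vertex e = 0 ->
    forall e, e \in tight B h p q -> w e = 0.
Proof.
move=> tri pq w wv e eG.
have simp : is_simplex (conv (tight B h p q) (@root_vertex R d n)).
  by apply/tri/tight_cell => //; apply/set0Pn; exists e.
apply: (simplex_vertices_independent simp _ _ wv) eG => [e' _|].
  by exists (row_mx (delta_mx 0 e'.1) (- delta_mx 0 e'.2)) => e'' _;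
     exact: root_vertex_exposed.
have := congr1 (pairing (row_mx (const_mx 1) 0)) wv.
rewrite pairing_sum /pairing mulmx0 [RHS]mxE => S.
rewrite -[RHS]S; apply: eq_bigr => e' _.
by rewrite -/(pairing _ _) pairing_root !mxE subr0 mulr1.
Qed.

Lemma independent_interpolation N (T : finType) (I : {set T})
    (v : T -> 'cV[R]_N) (g : T -> R) :
  (forall w : T -> R, \sum_(e in I) w e *: v e = 0 ->
     forall e, e \in I -> w e = 0) ->
  exists c : 'rV[R]_N, forall e, e \in I -> pairing c (v e) = g e.
Proof.
move=> indep.
have [->|/set0Pn[e0 e0I]] := eqVneq I finset.set0.
  by exists 0 => e; rewrite inE.
pose M := \matrix_(i < #|I|, j < N) v (enum_val i) j 0.
have Mfree : row_free M.
  apply: inj_row_free => x xM; apply/rowP => i; rewrite mxE.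
  have := indep (fun e => x 0 (enum_rank_in e0I e)) _ _ (enum_valP i).
  rewrite enum_valK_in; apply; rewrite big_enum_val /=.
  under eq_bigr do rewrite enum_valK_in.
  apply/colP => j; move/rowP/(_ j): xM; rewrite !mxE => <-.
  by rewrite summxE; apply: eq_bigr => i' _; rewrite !mxE.
exists (pinvmx M *m \col_i g (enum_val i))^T => e eI.
have : M *m (pinvmx M *m \col_i g (enum_val i)) = \col_i g (enum_val i).
  by rewrite mulmxA mulmxVp // mul1mx.
move/colP/(_ (enum_rank_in eI e)); rewrite [RHS]mxE enum_rankK_in // => <-.
rewrite /pairing [LHS]mxE [RHS]mxE; apply: eq_bigr => j _.
by rewrite [X in X * _]mxE mulrC [X in _ = X * _]mxE enum_rankK_in.
Qed.

Lemma small_scale (T : finType) (P : pred T) (f g : T -> R) :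
  (forall t, P t -> 0 < g t) ->
  exists2 eps, 0 < eps & forall t, P t -> eps * f t < g t.
Proof.
move=> g0; have pos t : 0 < 1 + `|f t| by rewrite ltr_pwDl.
exists (\big[Num.min/1]_(t | P t) (g t / (1 + `|f t|))).
  by apply: lt_bigmin => // t Pt; rewrite divr_gt0 ?g0.
move=> t Pt; set eps := \big[_/_]_(_ | _) _.
have eps0 : 0 < eps.
  by apply: lt_bigmin => // s Ps; rewrite divr_gt0 ?g0.
have : eps <= g t / (1 + `|f t|) by exact: bigmin_le_cond.
rewrite ler_pdivlMr // mulrDr mulr1 => H.
have : eps * f t <= eps * `|f t| by rewrite ler_pM2l // ler_norm.
by move: H eps0; lra.
Qed.

(** Only the tight edges constrain the direction of the move; the others stay
slack when eps is small enough. *)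
Lemma strict_potential B h (phi : 'I_n -> 'I_d) p q :
  is_triangulation (regular_subdivision B root_vertex h) ->
  (forall e, e \in B -> p e.1 + q e.2 <= h e) ->
  (forall k, (phi k, k) \in B) ->
  (forall k, p (phi k) + q k = h (phi k, k)) ->
  exists (p' : 'I_d -> R) (q' : 'I_n -> R),
    (forall k, p' (phi k) + q' k = h (phi k, k)) /\
    (forall e, e \in B -> phi e.2 != e.1 -> p' e.1 + q' e.2 < h e).
Proof.
move=> tri pq phiB pqphi.
have [c cG] := independent_interpolation
  (fun e => - (phi e.2 != e.1)%:R) (tight_independent tri pq).
pose s i := c 0 (lshift n i); pose r k := - c 0 (rshift d k).
have cE e : pairing c (root_vertex e) = s e.1 + r e.2.
  rewrite -[c]hsubmxK pairing_root !mxE //.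
have [|eps eps0 small] := @small_scale _
  (fun e => (e \in B) && (p e.1 + q e.2 != h e)) (fun e => s e.1 + r e.2)
  (fun e => h e - (p e.1 + q e.2)).
  by move=> e /andP[eB ne]; rewrite subr_gt0 lt_neqAle ne pq.
have sr e : e \in B -> p e.1 + q e.2 = h e ->
    s e.1 + r e.2 = - (phi e.2 != e.1)%:R.
  by move=> eB eh; rewrite -cE cG // inE eB eh eqxx.
exists (fun i => p i + eps * s i), (fun k => q k + eps * r k).
split=> [k|e eB phie].
  have := sr (phi k, k) (phiB k) (pqphi k); rewrite /= eqxx oppr0 => srk.
  by rewrite addrACA -mulrDr srk mulr0 addr0.
rewrite addrACA -mulrDr addrC -ltrBrDr.
have [eh|ne] := eqVneq (p e.1 + q e.2) (h e); last by apply: small; rewrite eB.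
by rewrite sr // phie eh subrr mulrN1 oppr_lt0.
Qed.

End Cells.

(** * Coarse types and lattice points *)

Section CoarseTypes.
Context {R : realType} {d n : nat}.
Implicit Types (B : {set 'I_d * 'I_n}) (y : 'I_d * 'I_n -> R).
Implicit Types (A : 'M[\bar R]_(d, n)).

Lemma permutohedron_transport B (x : 'cV[R]_d) :
  permutohedron R B x -> exists y, transport B (fun i => x i 0) y.
Proof.
move=> [v [vP ->]]; have [w wP] := choice vP.
exists (fun e => if e \in B then w e.2 e.1 else 0).
split=> [e|e /negPf -> //|i|k].
- case: ifP => // eB; have [w0 _ _] := wP e.2.
  by apply: w0; rewrite inE -surjective_pairing.
- rewrite row_sum_col summxE; apply: eq_bigr => k _ /=.
  have [_ _ ->] := wP k; rewrite summxE big_mkcond /=.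
  rewrite (bigD1 i) //= big1 ?addr0 => [|j ji].
    by rewrite inE !mxE !eqxx mulr1.
  by rewrite !mxE eq_sym (negPf ji) mulr0; case: ifP.
- have [_ w1 _] := wP k; rewrite col_sum_row -w1 [RHS]big_mkcond /=.
  by apply: eq_bigr => i _; rewrite inE.
Qed.

Lemma plan_permutohedron B (phi : 'I_n -> 'I_d) :
  (forall k, (phi k, k) \in B) ->
  permutohedron R B (\col_i (\sum_k (phi k == i))%N%:R).
Proof.
move=> phiB; exists (fun k => delta_mx (phi k) 0); split=> [k|].
  by apply: conv_vertex; rewrite inE.
apply/colP => i; rewrite mxE summxE natr_sum; apply: eq_bigr => k _.
by rewrite mxE eqxx andbT eq_sym.
Qed.

Lemma fine_typeE A p i k : tropical_matrix A ->
  fine_type A p i k =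
  ((i, k) \in finite_graph A) &&
  [forall j, ((j, k) \in finite_graph A) ==>
     (p j 0 - fine (A j k) <= p i 0 - fine (A i k))].
Proof.
move=> [Aninfty _]; rewrite mxE !inE /=; congr nat_of_bool.
have [Aik|//] := boolP (A i k \is a fin_num); rewrite /=.
apply: eq_forallb => j; rewrite !mxE inE /= -{1}(fineK Aik).
have [Ajk|Ajk] := boolP (A j k \is a fin_num).
  by rewrite -{1}(fineK Ajk) -!EFinB lee_fin.
have -> : A j k = +oo%E.
  by move: (Aninfty j k) Ajk; case: (A j k).
by rewrite /= leNye.
Qed.

Lemma coarse_typeE A p i : coarse_type A p i = (\sum_k fine_type A p i k)%N.
Proof. by rewrite mnmE. Qed.

Lemma coarse_type_ge_plan A p : tropical_matrix A ->
  exists phi : 'I_n -> 'I_d, (forall k, (phi k, k) \in finite_graph A) /\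
    forall i, (\sum_k (phi k == i) <= coarse_type A p i)%N.
Proof.
move=> Atrop; have [_ Afin] := Atrop.
have /choice[phi phiP] k : exists i, fine_type A p i k = 1%N.
  have [i0 Ai0] := Afin k.
  case: (@arg_maxP _ R _ i0 (fun i => (i, k) \in finite_graph A)
    (fun i => p i 0 - fine (A i k))) => [|i iA imax]; first by rewrite inE.
  exists i; rewrite fine_typeE // iA.
  by case: forallP => // -[] j; apply/implyP; exact: imax.
exists phi; split=> [k|i].
  by have := phiP k; rewrite fine_typeE //; case: (_ \in _).
rewrite coarse_typeE; apply: leq_sum => k _.
by case: eqP => // <-; rewrite phiP.
Qed.

Lemma lattice_point_coarse_type A (z : 'cV[int]_d) :
  tropical_matrix A -> sufficiently_generic A ->
  lattice_points (permutohedron R (finite_graph A)) z ->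
  exists p : 'cV[R]_d, coarse_type A p = [multinom `|(z i 0)%R|%N | i < d].
Proof.
move=> Atrop Agen zP.
pose h (e : 'I_d * 'I_n) := fine (A e.1 e.2).
have [y yT] := permutohedron_transport zP.
have zint i : (map_mx intr z : 'cV[R]_d) i 0 \is a Num.int.
  by rewrite mxE intr_int.
have [phi [phiT phimin]] := optimal_plan h zint yT.
have [p [q [pq pqphi]]] := transport_dual phiT phimin.
have phiB k : (phi k, k) \in finite_graph A.
  have [_ phi0 _ _] := phiT; apply: contraT => /phi0.
  by rewrite /plan_of eqxx => /eqP; rewrite oner_eq0.
have [p' [q' [tightp slackp]]] := strict_potential Agen pq phiB pqphi.
exists (\col_i p' i); apply/mnmP => i; rewrite coarse_typeE mnmE.
have -> : `|(z i 0)%R|%N = (\sum_k (phi k == i))%N.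
  have [_ _ /(_ i) + _] := phiT; rewrite row_sum_plan mxE => /esym/eqP.
  by rewrite -[X in _ == X]/((Posz _)%:~R) eqr_int => /eqP ->.
apply: eq_bigr => k _; rewrite fine_typeE //; congr nat_of_bool.
have [<-|phik] := eqVneq (phi k) i.
  rewrite phiB; apply/forallP => j; apply/implyP => jB; rewrite !mxE.
  have := tightp k; rewrite /h /=.
  have [->|phij] := eqVneq (phi k) j; first by [].
  by have := slackp _ jB phij; rewrite /h /=; lra.
have [iB|//] := boolP (_ \in _); rewrite /=.
apply/negbTE/forallPn; exists (phi k); rewrite phiB /= !mxE -ltNge.
by have := slackp _ iB phik; have := tightp k; rewrite /h /=; lra.
Qed.

End CoarseTypes.

Local Open Scope classical_set_scope.

Lemma ideal_gen_sub (S : comNzRingType) (G G' : set S) :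
  (forall g, G g -> exists c g', G' g' /\ g = c * g') ->
  ideal_gen G `<=` ideal_gen G'.
Proof.
move=> GG' f [m [c [g [gG ->]]]].
have /choice[c' /choice[g' H]] i : exists c' g', G' g' /\ g i = c' * g'.
  exact: GG'.
exists m, (fun i => c i * c' i), g'; split=> [i|]; first by have [] := H i.
by apply: eq_bigr => i _; have [_ ->] := H i; rewrite mulrA.
Qed.

Unset Implicit Arguments.

Theorem corollary4p7 (k : fieldType) (R : realType) (d n : nat)
    (A : 'M[\bar R]_(d, n)) :
  tropical_matrix A ->
  sufficiently_generic A ->
  coarse_type_ideal k A =
  ideal_gen
    [set lattice_monomial k z |
       z in lattice_points (permutohedron R (finite_graph A))].
Proof.
move=> Atrop Agen; apply/seteqP; split; apply: ideal_gen_sub.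
- move=> _ [p _ <-]; have [phi [phiB phile]] := coarse_type_ge_plan p Atrop.
  pose z : 'cV[int]_d := \col_i (\sum_k (phi k == i))%N%:Z.
  exists 'X_[coarse_type A p - [multinom `|(z i 0)%R|%N | i < d]],
    (lattice_monomial k z); split.
    exists z => //; rewrite /lattice_points /=.
    have -> : map_mx intr z = \col_i (\sum_k (phi k == i))%N%:R :> 'cV[R]_d.
      by apply/colP => i; rewrite !mxE.
    exact: plan_permutohedron.
  rewrite -mpolyXD submK //; apply/mnm_lepP => i; rewrite mnmE mxE.
  exact: phile.
- move=> _ [z zP <-]; have [p pz] := lattice_point_coarse_type Atrop Agen zP.
  exists 1, (lattice_monomial k z); split; last by rewrite mul1r.
  by exists p => //; rewrite pz.
Qed.
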